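(* Consider majority logic circuits over primary inputs $a,b,c_{in}$: acyclic networks of majority gates $M_k$ (each of arbitrary odd fan-in $k$, where $M_k$ outputs $1$ iff at least $\lceil k/2\rceil$ of its inputs are $1$) whose inputs are primary inputs, constants $0,1$, or outputs of other gates, each possibly complemented, and whose outputs are gate outputs, possibly complemented; inverters are not counted as majority operators. The full-adder is the two-output function $sum=a\oplus b\oplus c_{in}$, $c_{out}=M_3(a,b,c_{in})$. The circuit with the two gates $m=M_3(a,b,c_{in})$ and $sum=M_5(a,\neg m,\neg m,b,c_{in})$, with $c_{out}=m$, implements the full-adder and has the minimum number of majority operators (namely two) among all majority logic circuits implementing the full-adder. *)

(* Defs.v *)
From mathcomp Require Import all_boot.

Set Implicit Arguments.
Unset Strict Implicit.
Unset Printing Implicit Defensive.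

Definition maj (s : seq bool) : bool := uphalf (size s) <= count id s.

Section Circuit.

Variables I O : Type.

Inductive source (n : nat) : Type :=
  | Input of I
  | Const of bool
  | Gate of 'I_n.

(* Repeated literals in [fanin g] count with multiplicity.  In a pair
   [(c, x)], [c = true] means that [x] is complemented. *)
Record circuit : Type := Circuit {
  ngates : nat;
  fanin : 'I_ngates -> seq (bool * source ngates);
  output : O -> bool * 'I_ngates
}.

Definition wire (C : circuit) : rel 'I_(ngates C) :=
  fun h g => has (fun l => if l.2 is Gate h' then h' == h else false) (fanin g).

(* [cycle] accepts the empty sequence and, for singletons, detects
   self-loops. *)
Definition acyclic (C : circuit) : Prop :=
  forall p : seq 'I_(ngates C), cycle (@wire C) p -> p = [::].

Definition majority_circuit (C : circuit) : Prop :=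
  (forall g : 'I_(ngates C), odd (size (fanin g))) /\ acyclic C.

Definition source_val n (x : I -> bool) (v : {ffun 'I_n -> bool})
    (s : source n) : bool :=
  match s with Input i => x i | Const b => b | Gate g => v g end.

Definition literal_val n (x : I -> bool) (v : {ffun 'I_n -> bool})
    (l : bool * source n) : bool :=
  l.1 (+) source_val x v l.2.

Definition valuation (C : circuit) (x : I -> bool)
    (v : {ffun 'I_(ngates C) -> bool}) : Prop :=
  forall g, v g = maj [seq literal_val x v l | l <- fanin g].

(* For acyclic circuits there is exactly one valuation per input assignment:
   see [valuation_exists_unique] below. *)
Definition implements (C : circuit) (f : (I -> bool) -> O -> bool) : Prop :=
  forall x : I -> bool, exists2 v : {ffun 'I_(ngates C) -> bool},
    valuation x v &
    forall o, (output C o).1 (+) v (output C o).2 = f x o.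

Section Semantics.

Variable C : circuit.
Hypothesis acC : acyclic C.

Let rank (g : 'I_(ngates C)) := #|[pred h | connect (@wire C) h g]|.

Let rank_lt h g : wire h g -> rank h < rank g.
Proof.
move=> hg; apply: proper_card; apply/properP; split.
  by apply/subsetP=> k; rewrite !inE => kh; exact: connect_trans (connect1 hg).
exists g; rewrite !inE ?connect0 //; apply/negP=> /connectP[p gp hE].
suff: cycle (@wire C) (g :: p) by move/acC.
by rewrite /= rcons_path gp -hE.
Qed.

Let eq_maj x (v w : {ffun 'I_(ngates C) -> bool}) g :
  (forall h, wire h g -> v h = w h) ->
  maj [seq literal_val x v l | l <- fanin g] =
  maj [seq literal_val x w l | l <- fanin g].
Proof.
rewrite /wire => E; congr maj; elim: (fanin g) E => //= l s IH E.
rewrite IH => [|h hs]; last by apply: E; rewrite hs orbT.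
congr (_ :: _); case: l E => c [i|b|h] //= E.
by rewrite /literal_val /= E ?eqxx.
Qed.

Lemma valuation_exists_unique (x : I -> bool) :
  exists! v : {ffun 'I_(ngates C) -> bool}, valuation x v.
Proof.
pose step (v : {ffun 'I_(ngates C) -> bool}) : {ffun 'I_(ngates C) -> bool} :=
  [ffun g => maj [seq literal_val x v l | l <- fanin g]].
pose v k := iter k step [ffun => false].
have stable k : forall g, rank g <= k -> v k.+1 g = v k g.
  elim: k => [|k IH] g gk.
    by move: gk; rewrite leqn0 => /eqP/card0_eq/(_ g); rewrite inE connect0.
  rewrite /v 2![iter _.+1 _ _]iterS !ffunE; apply: eq_maj => h /rank_lt hg.
  by apply: IH; rewrite -ltnS (leq_trans hg).
exists (v (ngates C)); split=> [g|w wP].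
  rewrite -stable; first by rewrite /v iterS ffunE.
  by rewrite -[leqRHS]card_ord max_card.
apply/ffunP=> g; have [m] := ubnP (rank g); elim: m g => // m IH g gm.
rewrite wP -stable; last by rewrite -[leqRHS]card_ord max_card.
rewrite /v iterS ffunE; apply: eq_maj => h /rank_lt hg.
by apply: IH; exact: leq_trans hg gm.
Qed.

End Semantics.

End Circuit.

Arguments Input {I n}.
Arguments Const {I n}.
Arguments Gate {I n}.

Inductive fa_input : Type := in_a | in_b | in_cin.
Inductive fa_output : Type := out_sum | out_cout.

Definition full_adder (x : fa_input -> bool) (o : fa_output) : bool :=
  match o with
  | out_sum => x in_a (+) x in_b (+) x in_cin
  | out_cout => maj [:: x in_a; x in_b; x in_cin]
  end.

(* Gate 0 is m = M_3(a, b, cin), gate 1 is M_5(a, ~m, ~m, b, cin). *)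
Definition fa_circuit : circuit fa_input fa_output :=
  let m : 'I_2 := ord0 in
  let s : 'I_2 := ord_max in
  @Circuit fa_input fa_output 2
    (fun g => if g == m then
        [:: (false, Input in_a); (false, Input in_b); (false, Input in_cin)]
      else
        [:: (false, Input in_a); (true, Gate m); (true, Gate m);
            (false, Input in_b); (false, Input in_cin)])
    (fun o => match o with
      | out_sum => (false, s)
      | out_cout => (false, m)
      end).

(* Main.v *)
Require Import Defs.
From mathcomp Require Import all_boot.

(* In a circuit with a single gate both outputs are that gate up to
   complementation, so [sum (+) cout] would be constant; but it is [false] at
   [000] and [true] at [100]. *)

(** If [s] of the three inputs are true, the five-input gate counts 2, 3, 2, 3 true literals for [s]
    = 0, 1, 2, 3, so it reaches its threshold 3 exactly when [s] is odd: it computes the parity.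
    Minimality rests on [same_gate_outputs_addb]. *)

(** Indices grow along wires, so following a cycle through [g] would give [g < g]. *)
Lemma acyclic_of_topological_order (I O : Type) (C : circuit I O) :
  (forall h g, @wire I O C h g -> h < g) -> acyclic C.
Proof.
move=> wire_lt [|g p] //= /(sub_path (e' := relpre val ltn) wire_lt) gp.
have lt_trans : transitive (relpre (val : 'I_(ngates C) -> nat) ltn).
  by move=> y x z; exact: ltn_trans.
have /allP/(_ g) := order_path_min lt_trans gp.
by rewrite mem_rcons inE eqxx /= ltnn => /(_ isT).
Qed.

(** The shared gate value cancels in the xor, leaving only the complementation bits. *)
Lemma same_gate_outputs_addb (I O : Type) (C : circuit I O)
    (f : (I -> bool) -> O -> bool) (o1 o2 : O) :
  implements C f -> (output C o1).2 = (output C o2).2 ->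
  forall x, f x o1 (+) f x o2 = (output C o1).1 (+) (output C o2).1.
Proof.
move=> fC eq_gate x; have [v _ vE] := fC x.
by rewrite -!vE eq_gate addbACA addbb addbF.
Qed.

Theorem theorem3 :
  [/\ majority_circuit fa_circuit,
      implements fa_circuit full_adder,
      ngates fa_circuit = 2
    & forall C : circuit fa_input fa_output,
        majority_circuit C -> implements C full_adder ->
        ngates fa_circuit <= ngates C].
Proof.
split=> //.
- split=> [g|]; first by rewrite /=; case: ifP.
  apply: acyclic_of_topological_order => h g.
  by case: g => [[|[|g]]] // ?; case: h => [[|[|h]]].
- move=> x; pose m := maj [:: x in_a; x in_b; x in_cin].
  exists [ffun g : 'I_2 =>
            if g == ord0 then m else x in_a (+) x in_b (+) x in_cin].
    move=> g; rewrite ffunE /= /m; case: (g == ord0) => //=.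
    rewrite /literal_val /= !ffunE /=.
    by case: (x in_a) (x in_b) (x in_cin) => [] [] [].
  by case; rewrite ffunE.
- move=> C _ fC; rewrite leqNgt; apply/negP => C_lt2.
  have eq_gate : (output C out_sum).2 = (output C out_cout).2.
    apply/val_inj => /=; move: (ltn_ord (output C out_sum).2).
    move: (ltn_ord (output C out_cout).2).
    move: (nat_of_ord _) (nat_of_ord _) C_lt2 => i j.
    (* With no gate an output has no index to point to; with one gate both indices are 0. *)
    by case: (ngates C) => [|[|n]] //; case: i; case: j.
  have sumE := same_gate_outputs_addb _ _ _ _ _ _ fC eq_gate.
  have := sumE (fun i => if i is in_a then true else false).
  by rewrite -(sumE (fun=> false)).
Qed.
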